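(* There are infinitely many elliptic curves of the form $$E_t:\ y^2=x^3-(t^2+1)^2x+(2t)^2,\qquad t\in\mathbb{Q},$$ with rank $\geq 3$; that is, there are infinitely many $t\in\mathbb{Q}$ for which $E_t$ is an elliptic curve over $\mathbb{Q}$ of rank at least $3$.
   Context: The rank of an elliptic curve $E$ over $\mathbb{Q}$ is the nonnegative integer $r$ such that $E(\mathbb{Q})\cong\mathbb{Z}^r\times E(\mathbb{Q})_{\mathrm{tors}}$. *)

(* Defs.v *)
From HB Require Import structures.
From mathcomp Require Import all_boot all_order all_algebra.
From mathcomp Require Import boolp classical_sets cardinality.
From mathcomp Require Import ring.

Set Implicit Arguments.
Unset Strict Implicit.
Unset Printing Implicit Defensive.

Import GRing.Theory.

Local Open Scope ring_scope.

Definition disc (F : fieldType) (a b : F) : F :=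
  - 16%:R * (4%:R * a ^+ 3 + 27%:R * b ^+ 2).

(* The elliptic curve y^2 = x^3 + a x + b; since 16 divides the discriminant,
   disc_neq0 also excludes characteristic 2. *)
Record ellCurve (F : fieldType) := EllCurve {
  ell_a : F;
  ell_b : F;
  disc_neq0 : disc ell_a ell_b != 0 }.

Section RawPoints.
Variables (F : fieldType) (E : ellCurve F).
Local Notation a := (ell_a E).
Local Notation b := (ell_b E).
Implicit Types p q r : option (F * F).

(* None is the point at infinity. *)
Definition on_curve p : bool :=
  if p is Some (x, y) then y ^+ 2 == x ^+ 3 + a * x + b else true.

Definition oppo p : option (F * F) :=
  if p is Some (x, y) then Some (x, - y) else None.

Definition slope (x1 y1 x2 y2 : F) : F :=
  if x1 == x2 then (3%:R * x1 ^+ 2 + a) / (2%:R * y1)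
  else (y2 - y1) / (x2 - x1).

Definition addo p q : option (F * F) :=
  match p, q with
  | None, _ => q
  | _, None => p
  | Some (x1, y1), Some (x2, y2) =>
    if (x1 == x2) && (y1 == - y2) then None else
    let l := slope x1 y1 x2 y2 in
    let x3 := l ^+ 2 - x1 - x2 in
    Some (x3, l * (x1 - x3) - y1)
  end.

Lemma two_neq0 : 2%:R != 0 :> F.
Proof.
have := disc_neq0 E; apply: contraNneq => h.
have -> : disc a b = 2%:R * (- 8%:R * (4%:R * a ^+ 3 + 27%:R * b ^+ 2)).
  by rewrite /disc; ring.
by rewrite h mul0r.
Qed.

(* The two equations pin down the slope of the chord or tangent uniformly. *)
Lemma slopeP x1 y1 x2 y2 :
  on_curve (Some (x1, y1)) -> on_curve (Some (x2, y2)) ->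
  (x1 == x2) && (y1 == - y2) = false ->
  (slope x1 y1 x2 y2 * (x2 - x1) = y2 - y1) /\
  (slope x1 y1 x2 y2 * (y1 + y2) = x1 ^+ 2 + x1 * x2 + x2 ^+ 2 + a).
Proof.
rewrite /slope /= => /eqP e1 /eqP e2; case: eqP => [e12|/eqP n12] /=.
  rewrite -e12 in e2 * => /negbT ny.
  have ey : y1 = y2.
    apply/eqP; rewrite -subr_eq0; move: ny; rewrite -subr_eq0 opprK => ny.
    have : (y1 - y2) * (y1 + y2) == 0.
      by rewrite -subr_sqr e1 e2 subrr.
    by rewrite mulf_eq0 (negPf ny) orbF.
  move: ny; rewrite -ey -subr_eq0 opprK => ny.
  have y0 : y1 != 0 by apply: contraNneq ny => ->; rewrite addr0.
  have t := two_neq0.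
  by split; field; rewrite ?t ?y0.
move=> _; have d : x2 - x1 != 0 by rewrite subr_eq0 eq_sym.
split; first by rewrite divfK.
apply: (mulIf d); rewrite mulrAC divfK //.
have -> : (y2 - y1) * (y1 + y2) = y2 ^+ 2 - y1 ^+ 2 by ring.
by rewrite e1 e2; ring.
Qed.

Lemma addo_slope l x1 y1 x2 y2 (x3 := l ^+ 2 - x1 - x2) :
  on_curve (Some (x1, y1)) -> on_curve (Some (x2, y2)) ->
  (x1 == x2) && (y1 == - y2) = false ->
  l * (x2 - x1) = y2 - y1 ->
  l * (y1 + y2) = x1 ^+ 2 + x1 * x2 + x2 ^+ 2 + a ->
  addo (Some (x1, y1)) (Some (x2, y2)) = Some (x3, l * (x1 - x3) - y1).
Proof.
move=> o1 o2 nz s1 s2; have [t1 t2] := slopeP o1 o2 nz.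
rewrite /addo nz; suff -> : slope x1 y1 x2 y2 = l by [].
move: nz t1 t2; rewrite -s1 -s2.
have [<-|n12] := eqVneq x1 x2 => /= nz.
  by move=> _; apply: mulIf; rewrite addr_eq0 nz.
by move=> t1 _; apply: mulIf t1; rewrite subr_eq0 eq_sym.
Qed.

Lemma third_root l x1 y1 x2 y2 X :
  on_curve (Some (x1, y1)) ->
  l * (x2 - x1) = y2 - y1 ->
  l * (y1 + y2) = x1 ^+ 2 + x1 * x2 + x2 ^+ 2 + a ->
  X ^+ 3 + a * X + b =
  (l * (X - x1) + y1) ^+ 2 + (X - x1) * (X - x2) * (X - (l ^+ 2 - x1 - x2)).
Proof.
rewrite /= => /eqP o1 s1 s2.
have -> : b = y1 ^+ 2 - x1 ^+ 3 - a * x1 by rewrite o1; ring.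
have -> : a = l * (y1 + y2) - (x1 ^+ 2 + x1 * x2 + x2 ^+ 2) by rewrite s2; ring.
have -> : y2 = y1 + l * (x2 - x1) by rewrite s1; ring.
by ring.
Qed.

Lemma on_curve_opp p : on_curve (oppo p) = on_curve p.
Proof. by case: p => [[x y]|] //=; rewrite sqrrN. Qed.

Lemma on_curve_add p q : on_curve p -> on_curve q -> on_curve (addo p q).
Proof.
case: p q => [[x1 y1]|] [[x2 y2]|] // o1 o2.
case nz: ((x1 == x2) && (y1 == - y2)); first by rewrite /addo nz.
have [s1 s2] := slopeP o1 o2 nz.
rewrite (addo_slope o1 o2 nz s1 s2) /= (third_root _ o1 s1 s2).
by apply/eqP; ring.
Qed.

Lemma addo_comm p q : on_curve p -> on_curve q -> addo p q = addo q p.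
Proof.
case: p q => [[x1 y1]|] [[x2 y2]|] // o1 o2.
have sw : (x2 == x1) && (y2 == - y1) = (x1 == x2) && (y1 == - y2).
  by rewrite eq_sym; congr (_ && _); rewrite -!addr_eq0 addrC.
case nz: ((x1 == x2) && (y1 == - y2)); first by rewrite /addo sw nz.
have [s1 s2] := slopeP o1 o2 nz.
rewrite (addo_slope o1 o2 nz s1 s2).
move: (slope _ _ _ _) s1 s2 => l s1 s2.
rewrite (@addo_slope l x2 y2 x1 y1) ?sw //.
- congr (Some (_, _)); first by ring.
  have -> : y2 = l * (x2 - x1) + y1 by rewrite s1; ring.
  by ring.
- by rewrite -[LHS]opprK -mulrN opprB s1 opprB.
- by rewrite addrC s2; ring.
Qed.

Lemma oppoD p q : on_curve p -> on_curve q ->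
  oppo (addo p q) = addo (oppo p) (oppo q).
Proof.
case: p q => [[x1 y1]|] [[x2 y2]|] // o1 o2.
have sw : (x1 == x2) && (- y1 == - - y2) = (x1 == x2) && (y1 == - y2).
  by rewrite eqr_opp.
case nz: ((x1 == x2) && (y1 == - y2)).
  by rewrite /addo /oppo sw nz.
have [s1 s2] := slopeP o1 o2 nz.
rewrite (addo_slope o1 o2 nz s1 s2); move: (slope _ _ _ _) s1 s2 => l s1 s2.
rewrite [RHS](@addo_slope (- l)).
- by rewrite sqrrN /=; congr (Some (_, _)); ring.
- by rewrite -/(oppo (Some (x1, y1))) on_curve_opp.
- by rewrite -/(oppo (Some (x2, y2))) on_curve_opp.
- by rewrite sw.
- by rewrite mulNr s1; ring.
- by rewrite -s2; ring.
Qed.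

Lemma addoK p q : on_curve p -> on_curve q ->
  addo (addo p q) (oppo q) = p.
Proof.
case: p q => [[x1 y1]|] [[x2 y2]|] // o1 o2; last first.
  by rewrite /= opprK !eqxx.
case nz: ((x1 == x2) && (y1 == - y2)).
  rewrite /addo nz /=; case/andP: nz => /eqP -> /eqP ->.
  by [].
have [s1 s2] := slopeP o1 o2 nz.
have := on_curve_add o1 o2.
rewrite (addo_slope o1 o2 nz s1 s2); move: (slope _ _ _ _) s1 s2 => l s1 s2 o3.
have o2' : on_curve (oppo (Some (x2, y2))) by rewrite on_curve_opp.
have e2 : y2 = y1 + l * (x2 - x1) by rewrite s1; ring.
have ea : a = l * (y1 + y2) - (x1 ^+ 2 + x1 * x2 + x2 ^+ 2).
  by rewrite s2; ring.
rewrite [LHS](@addo_slope (- l) _ _ x2 (- y2)) //.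
- by rewrite sqrrN; congr (Some (_, _)); ring.
- rewrite opprK; apply/negP => /andP[/eqP e3 /eqP ey].
  rewrite e3 in ey.
  have y20 : y2 = 0.
    have : y2 + y2 = 0 by rewrite -{1}ey e2; ring.
    by move/eqP; rewrite -mulr2n -mulr_natl mulf_eq0 (negPf two_neq0) => /eqP.
  have ed : 3%:R * x2 ^+ 2 + a = 0.
    have -> : a = 2%:R * l * y2 - 3%:R * x2 ^+ 2.
      have ex : x1 = l ^+ 2 - 2%:R * x2 by rewrite mulr_natl mulr2n -{1}e3; ring.
      by rewrite ea e2 ex; ring.
    by rewrite y20; ring.
  move: o2 => /= /eqP; rewrite y20 expr0n /= => eb.
  have := disc_neq0 E; rewrite /disc.
  have -> : b = - (x2 ^+ 3 + a * x2) by apply/eqP; rewrite -addr_eq0 addrC -eb.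
  have -> : a = - (3%:R * x2 ^+ 2).
    by apply/eqP; rewrite -addr_eq0 addrC ed.
  by move/eqP; apply; ring.
- by rewrite e2; ring.
- by rewrite ea e2; ring.
Qed.

(* Coordinate form of associativity when only the first of the four additions may
   be a doubling: y = l x + u is the line through the first two points, and a and b
   have been eliminated in favour of l, u, x1 and x2. *)
Lemma addo_generic_coord (x1 x2 x3 l u y3 x4 y4 m x5 y5 : F)
    (n := (y3 - y4) / (x3 - x4)) (k := (y5 - (l * x1 + u)) / (x5 - x1)) :
  x4 = l ^+ 2 - x1 - x2 -> y4 = - (l * x4 + u) ->
  m = (y3 - (l * x2 + u)) / (x3 - x2) ->
  x5 = m ^+ 2 - x2 - x3 -> y5 = - (m * (x5 - x2) + (l * x2 + u)) ->
  y3 ^+ 2 = (l * x3 + u) ^+ 2 + (x3 - x1) * (x3 - x2) * (x3 - x4) ->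
  x3 - x2 != 0 -> x3 - x4 != 0 -> x5 - x1 != 0 ->
  n ^+ 2 - x4 - x3 = k ^+ 2 - x1 - x5 /\
  n * (x4 - (n ^+ 2 - x4 - x3)) - y4 =
  k * (x1 - (k ^+ 2 - x1 - x5)) - (l * x1 + u).
Proof.
move=> ex4 e4 em e5 ey5 e3 h1 h2 h3.
rewrite /n /k {n k}; move: h1 h2 h3.
rewrite ey5 e5 em e4 ex4 in e3 *.
move=> h1 h2 h3.
have h3' : (y3 - (l * x2 + u)) ^+ 2 + - x2 * (x3 - x2) ^+ 2
           + - x3 * (x3 - x2) ^+ 2 + - x1 * (x3 - x2) ^+ 2 != 0.
  apply: contraNneq h3 => h.
  rewrite -(inj_eq (mulIf (expf_neq0 2 h1))) mul0r -h.
  by apply/eqP; field.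
split.
- by field: e3; rewrite h2 h1 h3'.
- by field: e3; rewrite h2 h1 h3'.
Qed.

Lemma addo_generic x1 y1 x2 y2 x3 y3 x4 y4 x5 y5 :
  on_curve (Some (x1, y1)) -> on_curve (Some (x2, y2)) ->
  on_curve (Some (x3, y3)) ->
  addo (Some (x1, y1)) (Some (x2, y2)) = Some (x4, y4) ->
  addo (Some (x2, y2)) (Some (x3, y3)) = Some (x5, y5) ->
  x2 != x3 -> x4 != x3 -> x1 != x5 ->
  addo (Some (x4, y4)) (Some (x3, y3)) = addo (Some (x1, y1)) (Some (x5, y5)).
Proof.
move=> o1 o2 o3 eU eV n23 n43 n15.
case nz: ((x1 == x2) && (y1 == - y2)); first by rewrite /addo nz in eU.
have [s1 s2] := slopeP o1 o2 nz.
move: eU; rewrite (addo_slope o1 o2 nz s1 s2).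
move: (slope _ _ _ _) s1 s2 => l s1 s2 [e4 ey4].
move: eV; rewrite /addo /slope (negPf n23) (negPf n43) (negPf n15) /=.
move=> [e5 ey5].
have e2 : y2 = l * x2 + (y1 - l * x1) by rewrite -[LHS](subrK y1) -s1; ring.
have e1 : y1 = l * x1 + (y1 - l * x1) by ring.
have [|||||||||] := @addo_generic_coord x1 x2 x3 l (y1 - l * x1) y3 x4 y4
  ((y3 - y2) / (x3 - x2)) x5 y5.
- by rewrite -e4.
- by rewrite -ey4 -e4; ring.
- by rewrite -e2.
- by rewrite -e5.
- by rewrite -e2 -ey5 -e5; ring.
- move: o3 => /= /eqP ->; rewrite (third_root x3 o1 s1 s2) -e4; ring.
- by rewrite subr_eq0 eq_sym.
- by rewrite subr_eq0 eq_sym.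
- by rewrite subr_eq0 eq_sym.
by rewrite -e1 => -> ->.
Qed.

End RawPoints.

Record ellPoint (F : fieldType) (E : ellCurve F) := EllPoint {
  pval :> option (F * F);
  pvalP : on_curve E pval }.

HB.instance Definition _ F E := [isSub for @pval F E].
HB.instance Definition _ F E := [Choice of @ellPoint F E by <:].

Section PointGroup.
Variables (F : fieldType) (E : ellCurve F).
Local Notation pt := (ellPoint E).
Implicit Types P Q R : pt.

Definition zeropt : pt := @EllPoint F E None isT.
Definition opppt P : pt := EllPoint (etrans (on_curve_opp E (pval P)) (pvalP P)).
Definition addpt P Q : pt := EllPoint (on_curve_add (pvalP P) (pvalP Q)).

Local Notation "0" := zeropt.
Local Notation "- P" := (opppt P).
Local Notation "P + Q" := (addpt P Q).

Lemma addptC : commutative addpt.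
Proof. by move=> P Q; apply/val_inj/addo_comm; apply: pvalP. Qed.

Lemma add0pt : left_id 0 addpt.
Proof. by move=> P; apply/val_inj. Qed.

Lemma addpt0 : right_id 0 addpt.
Proof. by move=> P; rewrite addptC add0pt. Qed.

Lemma addNpt : left_inverse 0 opppt addpt.
Proof.
by case=> [[[x y]|] o]; apply/val_inj => //=; rewrite !eqxx.
Qed.

Lemma addptN P : P + - P = 0.
Proof. by rewrite addptC addNpt. Qed.

Lemma oppptK : involutive opppt.
Proof. by case=> [[[x y]|] o]; apply/val_inj => //=; rewrite opprK. Qed.

Lemma oppptD P Q : - (P + Q) = - P + - Q.
Proof. by apply/val_inj/oppoD; apply: pvalP. Qed.

Lemma addptK P Q : P + Q + - Q = P.
Proof. by apply/val_inj/addoK; apply: pvalP. Qed.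

Lemma addptKN P Q : P + - Q + Q = P.
Proof. by rewrite -{2}[Q]oppptK addptK. Qed.

Lemma addptI R P Q : P + R = Q + R -> P = Q.
Proof. by move=> h; rewrite -(addptK P R) h addptK. Qed.

Lemma addpt_eq0 P Q : P + Q = 0 -> Q = - P.
Proof. by move=> h; rewrite -(addptK Q P) [Q + P]addptC h add0pt. Qed.

Lemma same_x x y1 y2 :
  on_curve E (Some (x, y1)) -> on_curve E (Some (x, y2)) ->
  y1 = y2 \/ y1 = (- y2)%R.
Proof.
rewrite /= => /eqP <-; rewrite eqf_sqr => /orP[] /eqP ->; first by left.
by right; rewrite opprK.
Qed.

Lemma same_xP P Q x y1 y2 :
  pval P = Some (x, y1) -> pval Q = Some (x, y2) -> P = Q \/ P = - Q.
Proof.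
move=> eP eQ; have := pvalP P; have := pvalP Q; rewrite eP eQ => oQ oP.
by have [e|e] := same_x oP oQ; [left|right]; apply/val_inj; rewrite /= eP eQ e.
Qed.

Lemma addptA_generic P Q R :
  Q <> R -> Q <> - R -> P + Q <> R -> P + Q <> - R ->
  P <> Q + R -> P <> - (Q + R) ->
  P + Q + R = P + (Q + R).
Proof.
move=> nQR nQR' nUR nUR' nPV nPV'.
case eP: (pval P) => [[x1 y1]|]; last first.
  by have -> : P = 0 by [apply/val_inj]; rewrite !add0pt.
case eQ: (pval Q) => [[x2 y2]|]; last first.
  by have -> : Q = 0 by [apply/val_inj]; rewrite addpt0 add0pt.
case eR: (pval R) => [[x3 y3]|]; last first.
  by have -> : R = 0 by [apply/val_inj]; rewrite !addpt0.
case eU: (pval (P + Q)) => [[x4 y4]|]; last first.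
  have eU0 : P + Q = 0 by apply/val_inj.
  by rewrite (addpt_eq0 eU0) addptN add0pt [- P + R]addptC [RHS]addptC addptKN.
case eV: (pval (Q + R)) => [[x5 y5]|]; last first.
  have eV0 : Q + R = 0 by apply/val_inj.
  by rewrite (addpt_eq0 eV0) addptN addpt0 addptK.
apply/val_inj; rewrite -[LHS]/(addo E (pval (P + Q)) (pval R)).
rewrite -[RHS]/(addo E (pval P) (pval (Q + R))) eU eV eP eR.
apply: (@addo_generic F E x1 y1 x2 y2).
- by rewrite -eP pvalP.
- by rewrite -eQ pvalP.
- by rewrite -eR pvalP.
- by rewrite -eP -eQ -eU.
- by rewrite -eQ -eR -eV.
- by apply/eqP => e; move: eQ; rewrite e => /same_xP - /(_ _ _ eR)[].
- by apply/eqP => e; move: eU; rewrite e => /same_xP - /(_ _ _ eR)[].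
- by apply/eqP => e; move: eP; rewrite e => /same_xP - /(_ _ _ eV)[].
Qed.

Lemma addptA_quad P : P + P + (P + P) = P + (P + (P + P)).
Proof.
set S := P + P.
have cS : S + - P = P by rewrite /S addptK.
have [P0|nP0] := pselect (P = 0).
  by rewrite /S P0 !add0pt.
have [e1|n1] := pselect (S = - P).
  by rewrite e1 addptN addpt0 -oppptD -/S e1 oppptK.
have nSP : S <> P.
  by move=> e; apply/nP0/(@addptI P); rewrite add0pt -/S.
have [e2|n2] := pselect (S + S = P).
  by case: n1; apply: (@addptI S); rewrite e2 addptC.
have [e3|n3] := pselect (S + S = - P).
  have eP : P = - S + - S by rewrite -oppptD e3 oppptK.
  have -> : P + S = - S by rewrite {1}eP addptKN.
  by rewrite e3 {1}/S oppptD [RHS]addptC addptKN.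
have : S + S + - P = S + (S + - P).
  apply: addptA_generic; rewrite ?cS ?oppptK //.
move=> h; apply: (@addptI (- P)).
by rewrite h cS [P + (P + S)]addptC addptK addptC.
Qed.

Lemma addptA_double P R : P + P + R = P + (P + R).
Proof.
have [->|n1] := pselect (P = R); first exact: addptC.
have [e|n2] := pselect (P = - R).
  have -> : R = - P by rewrite e oppptK.
  by rewrite addptK addptN addpt0.
have [<-|n3] := pselect (P + P = R); first exact: addptA_quad.
have [e|n4] := pselect (P + P = - R).
  have -> : R = - P + - P by rewrite -oppptD e oppptK.
  rewrite -oppptD addptN [P + - _]addptC oppptD.
  by rewrite addptKN addptN.
have [e|n5] := pselect (P = P + R).
  have -> : R = 0 by apply: (@addptI P); rewrite add0pt addptC -e.
  by rewrite !addpt0.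
have [e|n6] := pselect (P = - (P + R)).
  by case: n4; rewrite {1}e oppptD [- P + _]addptC addptKN.
exact: addptA_generic.
Qed.

Lemma addptA_last P Q : P + Q + (P + Q) = P + (Q + (P + Q)).
Proof.
set R := P + Q.
have cR : R + - P = Q by rewrite /R [P + Q]addptC addptK.
apply: (@addptI (- P)).
by rewrite addptA_double cR [P + _]addptC addptK addptC.
Qed.

Lemma addptA : associative addpt.
Proof.
suff h P Q R : P + Q + R = P + (Q + R) by move=> P Q R; rewrite h.
have [->|n1] := pselect (Q = R).
  by rewrite [P + R]addptC addptC -addptA_double addptC.
have [e|n2] := pselect (Q = - R).
  by rewrite e addptKN addNpt addpt0.
have [<-|n3] := pselect (P + Q = R); first exact: addptA_last.
have [e|n4] := pselect (P + Q = - R).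
  have -> : R = - P + - Q by rewrite -oppptD e oppptK.
  by rewrite -oppptD addptN [Q + _]addptC oppptD addptKN addptN.
have [->|n5] := pselect (P = Q + R).
  rewrite [Q + R]addptC [LHS]addptC; symmetry.
  by rewrite addptA_last [R + Q + Q]addptC [Q + (R + Q)]addptC.
have [e|n6] := pselect (P = - (Q + R)).
  by rewrite e addNpt oppptD [- Q + _]addptC addptKN addNpt.
exact: addptA_generic.
Qed.

End PointGroup.

HB.instance Definition _ (F : fieldType) (E : ellCurve F) :=
  GRing.isZmodule.Build (ellPoint E)
    (@addptA F E) (@addptC F E) (@add0pt F E) (@addNpt F E).

Section Rank.
Variable G : zmodType.

Definition is_torsion : {pred G} :=
  fun x => `[< exists2 n, (0 < n)%N & x *+ n = 0 >].

Lemma is_torsion_zmod_closed : zmod_closed is_torsion.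
Proof.
split=> [|x y].
  by apply/asboolP; exists 1%N => //; rewrite mulr1n.
move=> /asboolP[m m0 xm] /asboolP[n n0 yn]; apply/asboolP.
exists (m * n)%N; first by rewrite muln_gt0 m0.
by rewrite mulrnBl mulrnA xm mul0rn mulnC mulrnA yn mul0rn subrr.
Qed.

HB.instance Definition _ :=
  GRing.isZmodClosed.Build G is_torsion is_torsion_zmod_closed.

Record torsion := Torsion { tval :> G; tvalP : tval \in is_torsion }.

HB.instance Definition _ := [isSub for tval].
HB.instance Definition _ := [Choice of torsion by <:].
HB.instance Definition _ := [SubChoice_isSubZmodule of torsion by <:].

Definition is_rank (r : nat) : Prop :=
  exists f : {additive ('rV[int]_r * torsion)%type -> G}, bijective f.

(* "The rank of G is at least n": every r such that G = Z^r x G_tors satisfies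
   n <= r. For G = E(Q) such an r exists by the Mordell-Weil theorem; for an
   arbitrary G the embedding of Z^n keeps this from holding vacuously. See rank_geE
   for the agreement with is_rank. *)
Definition rank_ge (n : nat) : Prop :=
  (exists f : {additive 'rV[int]_n -> G}, injective f) /\
  (forall r, is_rank r -> (n <= r)%N).

End Rank.

Lemma int_dependence n r (M : 'M[int]_(n, r)) : (r < n)%N ->
  exists2 w : 'rV[int]_n, w != 0 & w *m M = 0.
Proof.
move=> lt_rn; pose A := map_mx (intr : int -> rat) M.
have : kermx A != 0.
  rewrite kermx_eq0 /row_free neq_ltn.
  by rewrite (leq_ltn_trans (rank_leq_col A)).
case/rowV0Pn=> u /sub_kermxP uA u0.
pose d := \prod_j denq (u 0 j).
have d0 : d%:~R != 0 :> rat.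
  by rewrite intr_eq0; apply/prodf_neq0 => j _; apply: denq_neq0.
pose w := \row_j (numq (u 0 j) * \prod_(k | k != j) denq (u 0 k)).
have wE : map_mx intr w = d%:~R *: u :> 'rV[rat]_n.
  apply/rowP => j; rewrite !mxE.
  have -> : d = denq (u 0 j) * \prod_(k | k != j) denq (u 0 k).
    by rewrite /d (bigD1 j).
  rewrite !intrM mulrAC; congr (_ * _).
  by rewrite mulrC -{2}[u 0 j]divq_num_den divfK // intr_eq0 denq_neq0.
exists w.
  apply: contraNneq u0 => w0; move/eqP: wE.
  by rewrite w0 map_mx0 eq_sym scaler_eq0 (negPf d0).
have /matrixP wA : map_mx intr (w *m M) = 0 :> 'M[rat]_(1, r).
  by rewrite map_mxM /= wE -scalemxAl uA scaler0.
apply/matrixP => i j; move: (wA i j); rewrite mxE [RHS]mxE => /eqP.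
by rewrite intr_eq0 => /eqP ->; rewrite mxE.
Qed.

Lemma zmod_morphism_mulmx n r (p : 'rV[int]_n -> 'rV[int]_r) v :
  zmod_morphism p -> p v = v *m \matrix_i p (delta_mx 0 i).
Proof.
move=> pB; pose q : {additive 'rV[int]_n -> 'rV[int]_r} :=
  HB.pack p (GRing.isZmodMorphism.Build _ _ p pB).
rewrite mulmx_sum_row -[p]/(q : _ -> _) {1}[v]row_sum_delta raddf_sum.
by apply: eq_bigr => i _; rewrite rowK -[v 0 i]intz !scaler_int raddfMz.
Qed.

Lemma is_rank_embedding (G : zmodType) n r (f : {additive 'rV[int]_n -> G}) :
  injective f -> is_rank G r -> (n <= r)%N.
Proof.
move=> fI [g [h gK hK]]; rewrite leqNgt; apply/negP => lt_rn.
pose p v := (h (f v)).1.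
have pB : zmod_morphism p.
  by move=> x y; rewrite /p raddfB (can2_zmod_morphism gK hK).
have [w w0 wM] := int_dependence (\matrix_i p (delta_mx 0 i)) lt_rn.
rewrite -(zmod_morphism_mulmx w pB) /p in wM.
have efw : f w = g (0, (h (f w)).2) by rewrite -wM -surjective_pairing hK.
move: efw; case: (h _).2 => t /[dup] /asboolP[m m0 tm] tP efw.
have : f (w *+ m) = f 0.
  rewrite raddfMn efw -raddfMn raddf0 (_ : _ *+ m = 0) ?raddf0 //.
  rewrite [LHS]surjective_pairing (raddfMn fst) (raddfMn snd) /= mul0rn.
  by congr (_, _); apply/val_inj; rewrite (raddfMn val).
move/fI/rowP => wm; case/eqP: w0; apply/rowP => j.
by have /eqP := wm j; rewrite mulmxnE !mxE Num.Theory.mulrn_eq0 eqn0Ngt m0 => /eqP.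
Qed.

Lemma rank_geE (G : zmodType) n r :
  is_rank G r -> (rank_ge G n <-> (n <= r)%N).
Proof.
move=> rG; split=> [[_ /(_ r rG)] //|le_nr].
suff [f fI] : exists f : {additive 'rV[int]_n -> G}, injective f.
  by split=> [|s]; [exists f | apply: is_rank_embedding fI].
have [g [h gK _]] := rG.
pose f (v : 'rV[int]_n) := g (v *m pid_mx n, 0).
have fB : zmod_morphism f.
  move=> x y; rewrite /f -raddfB; congr (g _).
  by apply/eqP; rewrite xpair_eqE mulmxBl /= subr0 !eqxx.
pose f' : {additive 'rV[int]_n -> G} :=
  HB.pack f (GRing.isZmodMorphism.Build _ _ f fB).
exists f'.
move=> x y /= /(can_inj gK) [] /(congr1 (mulmx^~ (pid_mx n : 'M_(r, n)))) /=.
by rewrite -!mulmxA !mul_pid_mx minnn (minn_idPr le_nr) pid_mx_1 !mulmx1.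
Qed.

(* Main.v *)
From HB Require Import structures.
Require Import Defs.
From mathcomp Require Import all_boot all_order all_algebra.
From mathcomp Require Import boolp classical_sets cardinality.
From mathcomp Require Import ring zify.
Import Order.TTheory GRing.Theory Num.Theory.
Set Implicit Arguments.
Unset Strict Implicit.
Unset Printing Implicit Defensive.
Local Open Scope ring_scope.

(** If t ^+ 2 + 6 is a square w ^+ 2, then E_t has the three rational points
    P1 = (0, 2t), P2 = (t ^+ 2 + 1, 2t) and P3 = (-1, t w): the value of the
    cubic at -1 is t ^+ 2 * (t ^+ 2 + 6). The conic t ^+ 2 + 6 = w ^+ 2 has the
    parametrization t = (m ^+ 2 - 6) / (2m), w = (m ^+ 2 + 6) / (2m), so there
    are infinitely many such t, and the three points turn out to be independent
    whenever m is an integer congruent to 1 modulo 285 = 3 * 5 * 19.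

    Independence is a descent modulo 2 (rank_ge_of_mod2). If E(Q) has no
    2-torsion and none of the seven nonempty partial sums of P1, P2, P3 lies in
    2E(Q), then a nontrivial relation n1 P1 + n2 P2 + n3 P3 = 0 could be halved
    until one of its coefficients is odd, which would place a partial sum in
    2E(Q).

    Both conditions are about rational roots of monic polynomials: 2-torsion
    gives a root of x ^+ 3 + a x + b, and P = 2Q makes x(Q) a root of a quartic
    whose coefficients are polynomials in a, b and x(P) (double_x_root). A
    rational root of a monic polynomial with p-integral coefficients reduces to
    a root modulo p (reduces_monic_root), so it is enough to see, for each
    polynomial, one prime p modulo which it has no root. For m = 1 modulo 285
    the cubic has no root modulo 3, which also yields a nonzero discriminant;
    the quartic of P2 has none modulo 5, and the quartics of the six other
    partial sums have none modulo 19. The coordinates of the sums of two or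
    three points are computed only modulo 19, by adding the reduced points
    (reduces_to_add). *)

(** * Reduction of rational numbers to a field *)

Section Reduction.
Variable F : fieldType.
Implicit Types (x y : rat) (a b : F).

(** The residue map of the localization of the integers at the kernel of
    their map to F, taken as a relation between rationals and residues. Here
    n / d ranges over all fractions equal to x, reduced or not, which makes
    compatibility with the field operations immediate. *)
Definition reduces x a : Prop := exists n d : int,
  [/\ d%:~R != 0 :> F, x * d%:~R = n%:~R & a * d%:~R = n%:~R].

Lemma reduces_int (n : int) : reduces n%:~R n%:~R.
Proof. by exists n, 1; rewrite oner_neq0 !mulr1. Qed.

Lemma reduces_nat (n : nat) : reduces n%:R n%:R.
Proof. exact: reduces_int n. Qed.

Lemma reducesD x y a b : reduces x a -> reduces y b -> reduces (x + y) (a + b).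
Proof.
move=> [n [d [d0 xd ad]]] [m [e [e0 ye be]]]; exists (n * e + m * d), (d * e).
rewrite !rmorphD !rmorphM /= mulf_neq0 // -xd -ad -ye -be.
by split=> //; ring.
Qed.

Lemma reducesM x y a b : reduces x a -> reduces y b -> reduces (x * y) (a * b).
Proof.
move=> [n [d [d0 xd ad]]] [m [e [e0 ye be]]]; exists (n * m), (d * e).
rewrite !rmorphM /= mulf_neq0 // -xd -ad -ye -be.
by split=> //; ring.
Qed.

Lemma reducesN x a : reduces x a -> reduces (- x) (- a).
Proof.
move=> [n [d [d0 xd ad]]]; exists (- n), d.
by rewrite !rmorphN /= -xd -ad !mulNr.
Qed.

Lemma reducesB x y a b : reduces x a -> reduces y b -> reduces (x - y) (a - b).
Proof. by move=> hx hy; apply/reducesD/reducesN. Qed.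

Lemma reducesX x a n : reduces x a -> reduces (x ^+ n) (a ^+ n).
Proof.
move=> hx; elim: n => [|n IHn]; first exact: (reduces_nat 1).
by rewrite !exprS; apply: reducesM.
Qed.

Lemma reduces_sum n (x : 'I_n -> rat) (a : 'I_n -> F) :
  (forall i, reduces (x i) (a i)) -> reduces (\sum_i x i) (\sum_i a i).
Proof.
move=> h; elim/big_rec2: _ => [|i b y _ hy]; first exact: (reduces_nat 0).
exact: reducesD.
Qed.

Lemma reduces_neq0 x a : reduces x a -> a != 0 -> x != 0.
Proof.
move=> [n [d [d0 xd ad]]]; apply: contraNneq => x0.
have n0 : n = 0 by apply/eqP; rewrite -(intr_eq0 rat) -xd x0 mul0r.
by move/eqP: ad; rewrite n0 mulf_eq0 (negPf d0) orbF.
Qed.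

Lemma reducesV x a : reduces x a -> a != 0 -> reduces x^-1 a^-1.
Proof.
move=> hx a0; have x0 := reduces_neq0 hx a0.
have [n [d [d0 xd ad]]] := hx; exists d, n.
by rewrite -xd -ad mulf_neq0 // !mulKf.
Qed.

Lemma reduces_div x y a b :
  reduces x a -> reduces y b -> b != 0 -> reduces (x / y) (a / b).
Proof. by move=> hx hy b0; apply/reducesM/reducesV. Qed.

Lemma reduces0 a : reduces 0 a -> a = 0.
Proof.
by move=> h; apply/eqP; apply: contraT => /(reduces_neq0 h); rewrite eqxx.
Qed.

(** This localization is a valuation ring: numerator and denominator of x are
    coprime, so a Bezout relation forbids that both vanish in F. *)
Lemma reduces_or_inv x :
  (exists a, reduces x a) \/ (x != 0 /\ reduces x^-1 0).
Proof.
have xE : x * (denq x)%:~R = (numq x)%:~R.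
  by rewrite -{1}[x]divq_num_den divfK // intr_eq0 denq_neq0.
have [d0|d0] := eqVneq ((denq x)%:~R : F) 0; last first.
  left; exists ((numq x)%:~R / (denq x)%:~R), (numq x), (denq x).
  by rewrite d0 xE divfK.
have n0 : (numq x)%:~R != 0 :> F.
  apply/eqP => n0; have /coprimezP[[u v] /= uv] : coprimez (numq x) (denq x).
    by rewrite coprimezE; exact: coprime_num_den.
  have /eqP := congr1 (intr : int -> F) uv.
  by rewrite rmorphD !rmorphM /= n0 d0 !mulr0 addr0 eq_sym oner_eq0.
have x0 : x != 0.
  by apply: contraNneq n0 => /eqP; rewrite -numq_eq0 => /eqP ->.
right; split=> //; exists (denq x), (numq x).
by rewrite n0 -xE mulKf // mul0r d0.
Qed.

(** The localization is integrally closed: if x were not integral, then x^-1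
    would reduce to 0, and dividing the equation by x ^+ n would reduce it to
    1 = 0. *)
Lemma reduces_monic_root n (c : nat -> rat) (e : nat -> F) x :
  (forall i, (i < n)%N -> reduces (c i) (e i)) ->
  x ^+ n + \sum_(i < n) c i * x ^+ i = 0 ->
  exists v : F, v ^+ n + \sum_(i < n) e i * v ^+ i = 0.
Proof.
move=> ce ex.
have [[a xa]|[nx0 x0]] := reduces_or_inv x.
  exists a; apply: reduces0; rewrite -ex.
  apply/reducesD; first exact: reducesX.
  by apply: reduces_sum => i; apply/reducesM/reducesX/xa/ce.
have : reduces (1 + \sum_(i < n) c i * x^-1 ^+ (n - i))
               (1 + \sum_(i < n) e i * 0 ^+ (n - i)).
  apply/reducesD; first exact: (reduces_nat 1).
  by apply: reduces_sum => i; apply/reducesM/reducesX/x0/ce.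
have -> : \sum_(i < n) e i * 0 ^+ (n - i) = 0.
  by apply: big1 => i _; rewrite expr0n subn_eq0 leqNgt ltn_ord mulr0.
rewrite addr0 => /reduces_neq0/(_ (oner_neq0 F))/eqP[].
apply: (mulIf (expf_neq0 n nx0)); rewrite mul0r; apply: etrans ex.
rewrite mulrDl mul1r mulr_suml.
congr (_ + _); apply: eq_bigr => i _; rewrite -mulrA; congr (_ * _).
have -> : x ^+ n = x ^+ (n - i) * x ^+ i.
  by rewrite -exprD subnK // ltnW.
by rewrite exprVn mulKf // expf_neq0.
Qed.

End Reduction.

(** * Independence modulo 2 in an abelian group *)

(** Write v = 2w + e with e the parities. If some entry of v is odd, the
    relation puts the partial sum selected by e in 2G; otherwise w is a
    relation with smaller entries, since 2-torsion is excluded. *)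
Lemma independent_of_mod2 (G : zmodType) n (P : 'I_n -> G) :
  (forall Q : G, Q *+ 2 = 0 -> Q = 0) ->
  (forall e : 'I_n -> bool, (exists i, e i) ->
     forall Q, Q *+ 2 <> \sum_i P i *+ e i) ->
  forall v : 'rV[int]_n, \sum_i P i *~ v 0 i = 0 -> v = 0.
Proof.
move=> tors2 indep v.
have [N leN] : exists N, forall i, (`|v 0%R i| <= N)%N.
  by exists (\sum_i `|v 0%R i|)%N => i; rewrite (bigD1 i) //= leq_addr.
elim: N v leN => [|N IHN] v leN relv.
  by apply/rowP => i; have := leN i; rewrite mxE leqn0 absz_eq0 => /eqP.
pose e i := odd `|v 0 i|; pose w : 'rV[int]_n := \row_i (v 0%R i %/ 2)%Z.
have vE i : v 0 i = w 0 i * 2 + (e i)%:Z by rewrite mxE /e; lia.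
have relw : (\sum_i P i *~ w 0 i) *+ 2 + \sum_i P i *+ e i = 0.
  apply: etrans _ relv; rewrite -sumrMnl -big_split /=; apply: eq_bigr => i _.
  by rewrite vE mulrzDr mulrzA.
have [[i ei]|ne] := pselect (exists i, e i).
  case: (indep e (ex_intro _ i ei) (- \sum_i P i *~ w 0 i)).
  by rewrite mulNrn; apply/eqP; rewrite eq_sym -addr_eq0 addrC relw.
have e0 i : e i = false by apply/negP => ei; apply: ne; exists i.
have w0 : w = 0.
  apply: IHN => [i|].
    by have := leN i; have := vE i; rewrite e0; lia.
  apply: tors2; apply: etrans _ relw.
  by rewrite [X in _ = _ + X]big1 ?addr0 // => i _; rewrite e0.
by apply/rowP => i; rewrite vE w0 e0 !mxE.
Qed.

Lemma rank_ge_of_mod2 (G : zmodType) n (P : 'I_n -> G) :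
  (forall Q : G, Q *+ 2 = 0 -> Q = 0) ->
  (forall e : 'I_n -> bool, (exists i, e i) ->
     forall Q, Q *+ 2 <> \sum_i P i *+ e i) ->
  rank_ge G n.
Proof.
move=> tors2 indep; pose f (v : 'rV[int]_n) := \sum_i P i *~ v 0 i.
have fB : zmod_morphism f.
  by move=> v w; rewrite /f -sumrB; apply: eq_bigr => i _; rewrite !mxE mulrzBr.
pose f' : {additive 'rV[int]_n -> G} :=
  HB.pack f (GRing.isZmodMorphism.Build _ _ f fB).
have f'I : injective f'.
  by apply: raddf_inj => v; apply: independent_of_mod2.
by split=> [|r]; [exists f' | apply: is_rank_embedding f'I].
Qed.

(** * Halving points and 2-torsion *)

Lemma pval_add (F : fieldType) (E : ellCurve F) (P Q : ellPoint E) :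
  pval (P + Q) = addo E (pval P) (pval Q).
Proof. by []. Qed.

(** Lower coefficients of the monic quartic whose roots are the x-coordinates
    of the halves of a point with x-coordinate x; see halvingE. *)
Definition halving_coef (F : fieldType) (a b x : F) : nat -> F :=
  nth 0 [:: a ^+ 2 - 4%:R * b * x; - (8%:R * b + 4%:R * a * x);
            - (2%:R * a); - (4%:R * x)].

Lemma halvingE (F : fieldType) (a b x u : F) :
  u ^+ 4 + \sum_(i < 4) halving_coef a b x i * u ^+ i =
  (u ^+ 2 - a) ^+ 2 - 8%:R * b * u - 4%:R * x * (u ^+ 3 + a * u + b).
Proof. by rewrite !big_ord_recr big_ord0 /halving_coef /=; ring. Qed.

(** The duplication formula
    x(2Q) = ((u ^+ 2 - a) ^+ 2 - 8 b u) / (4 (u ^+ 3 + a u + b)), u = x(Q),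
    with the denominator cleared. *)
Lemma double_x_root (F : fieldType) (E : ellCurve F) (P Q : ellPoint E) x y :
  pval P = Some (x, y) -> Q *+ 2 = P ->
  exists u, u ^+ 4 + \sum_(i < 4)
    halving_coef (ell_a E) (ell_b E) x i * u ^+ i = 0.
Proof.
move=> eP eQP; move: eP; rewrite -eQP mulr2n pval_add; have := pvalP Q.
case: (pval Q) => [[u v]|] //= /eqP oQ; rewrite eqxx /=.
case: eqP => // nv [ex _]; exists u.
have v0 : 2%:R * v != 0.
  rewrite mulf_neq0 ?(two_neq0 E) //; apply/eqP => v0.
  by apply: nv; rewrite v0 oppr0.
rewrite halvingE -ex /slope eqxx.
set a := ell_a E in oQ *; set b := ell_b E in oQ *.
have -> : b = v ^+ 2 - u ^+ 3 - a * u by rewrite oQ; ring.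
by field; rewrite andbC -negb_or -mulf_eq0.
Qed.

Definition cubic_coef (F : fieldType) (a b : F) : nat -> F :=
  nth 0 [:: b; a; 0].

Lemma cubicE (F : fieldType) (a b u : F) :
  u ^+ 3 + \sum_(i < 3) cubic_coef a b i * u ^+ i = u ^+ 3 + a * u + b.
Proof. by rewrite !big_ord_recr big_ord0 /cubic_coef /=; ring. Qed.

Lemma no_2torsion (F : fieldType) (E : ellCurve F) :
  (forall u, u ^+ 3 + ell_a E * u + ell_b E != 0) ->
  forall Q : ellPoint E, Q *+ 2 = 0 -> Q = 0.
Proof.
move=> nr Q Q2; apply/val_inj => /=.
move/(congr1 (@pval _ _)): Q2; rewrite mulr2n pval_add; have := pvalP Q.
case: (pval Q) => [[u v]|] //= /eqP oQ; rewrite eqxx /=.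
case: eqP => // vN _; have /eqP : 2%:R * v = 0.
  by rewrite mulr_natl mulr2n {1}vN addNr.
rewrite mulf_eq0 (negPf (two_neq0 E)) => /eqP v0.
by case/eqP: (nr u); rewrite -oQ v0 expr0n.
Qed.

(** If the discriminant vanishes and a is nonzero, the roots are 3b / a and
    twice - 3b / (2a), all in the base field; if a = 0 as well, then b = 0 and
    0 is a root. *)
Lemma disc_neq0_of_no_root (F : numFieldType) (a b : F) :
  (forall u, u ^+ 3 + a * u + b != 0) -> disc a b != 0.
Proof.
move=> nr; rewrite /disc mulf_neq0 ?oppr_eq0 ?pnatr_eq0 //; apply/eqP => d0.
have [a0|a0] := eqVneq a 0.
  have b0 : b = 0.
    apply/eqP; move/eqP: d0.
    by rewrite a0 expr0n mulr0 add0r mulf_eq0 pnatr_eq0 sqrf_eq0.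
  by case/eqP: (nr 0); rewrite a0 b0; ring.
case/eqP: (nr (3%:R * b / a)).
have -> : (3%:R * b / a) ^+ 3 + a * (3%:R * b / a) + b =
  b * (4%:R * a ^+ 3 + 27%:R * b ^+ 2) / a ^+ 3 by field.
by rewrite d0 mulr0 mul0r.
Qed.

(** * Reduction of points *)

Lemma cubic_rootless (F : fieldType) (A B : rat) (a b : F) :
  reduces A a -> reduces B b -> (forall v : F, v ^+ 3 + a * v + b != 0) ->
  forall u, u ^+ 3 + A * u + B != 0.
Proof.
move=> rA rB nr u; apply/eqP; rewrite -cubicE.
case/(@reduces_monic_root F 3 _ (cubic_coef a b)) => [i i3|v].
  by move: i i3; do 3?[case=> [_|] /=] => //; exact: (reduces_nat _ 0).
by rewrite cubicE; apply/eqP/nr.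
Qed.

Section PointReduction.
Variables (E : ellCurve rat) (F : fieldType).
Implicit Types (P Q : ellPoint E) (x y : F).

Definition reduces_to P x y : Prop :=
  exists X Y, [/\ pval P = Some (X, Y), reduces X x & reduces Y y].

(** Reduction commutes with the chord construction as long as the reduced points
    have distinct x-coordinates. The slope l and the sum (x3, y3) are
    characterized by equations, so that concrete instances hold by computation
    without inverting anything in F. *)
Lemma reduces_to_add l P Q x1 y1 x2 y2 x3 y3 :
  reduces_to P x1 y1 -> reduces_to Q x2 y2 ->
  [&& x1 != x2, l * (x1 - x2) == y1 - y2, x3 == l ^+ 2 - x1 - x2
    & y3 == l * (x1 - x3) - y1] ->
  reduces_to (P + Q) x3 y3.
Proof.
move=> [X1 [Y1 [eP rX1 rY1]]] [X2 [Y2 [eQ rX2 rY2]]].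
move=> /and4P[nx /eqP el /eqP -> /eqP ->].
have d : x1 - x2 != 0 by rewrite subr_eq0.
have D := reduces_neq0 (reducesB rX1 rX2) d.
pose L := (Y1 - Y2) / (X1 - X2).
have rL : reduces L l.
  rewrite -(mulfK d l) el.
  by apply: reduces_div => //; apply: reducesB.
exists (L ^+ 2 - X1 - X2), (L * (X1 - (L ^+ 2 - X1 - X2)) - Y1); split.
- rewrite pval_add eP eQ /=; have nX : X1 != X2 by rewrite -subr_eq0.
  rewrite (negPf nX) /= /slope (negPf nX).
  have -> // : (Y2 - Y1) / (X2 - X1) = L.
  by rewrite -(opprB Y1) -(opprB X1) invrN mulrNN.
- by do 2?apply: reducesB => //; apply: reducesX.
- apply: reducesB => //; apply: reducesM => //.
  by do 3?apply: reducesB => //; apply: reducesX.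
Qed.

Variables a b : F.
Hypotheses (ra : reduces (ell_a E) a) (rb : reduces (ell_b E) b).

(** The criterion used to keep a point out of 2E(Q): the halving quartic has no
    root in the residue field. *)
Lemma not_double P x y : reduces_to P x y ->
  (forall v : F, (v ^+ 2 - a) ^+ 2 - 8%:R * b * v
     - 4%:R * x * (v ^+ 3 + a * v + b) != 0) ->
  forall Q, Q *+ 2 <> P.
Proof.
move=> [X [Y [eP rX rY]]] nr Q /(double_x_root eP)[u].
case/(@reduces_monic_root F 4 _ (halving_coef a b x)) => [i i4|v].
  move: i i4; do 4?[case=> [_|] /=] => //.
  - apply: reducesB; first exact: reducesX.
    by do !apply: reducesM => //; exact: reduces_nat.
  - by apply/reducesN/reducesD; do !apply: reducesM => //; exact: reduces_nat.
  - by apply/reducesN/reducesM => //; exact: reduces_nat.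
  - by apply/reducesN/reducesM => //; exact: reduces_nat.
by rewrite halvingE; apply/eqP/nr.
Qed.

End PointReduction.

(** Turns a statement about all residues modulo p into one that can be decided
    by evaluation. *)
Lemma forall_Fp p (A : pred 'F_p) : prime p ->
  all (fun k => A k%:R) (iota 0 p) -> forall v, A v.
Proof.
move=> p_pr /allP h v; rewrite -(natr_Zp v); apply: h.
by rewrite mem_iota /= add0n -[X in (_ < X)%N](Fp_cast p_pr) ltn_ord.
Qed.

(** * Three independent points on E_t *)

Section Family.
Variables t w : rat.
Hypothesis tw : t ^+ 2 + 6%:R = w ^+ 2.
Hypothesis t3 : reduces t (2%:R : 'F_3).
Hypothesis t5 : reduces t (0 : 'F_5).
Hypotheses (t19 : reduces t (7%:R : 'F_19)) (w19 : reduces w (13%:R : 'F_19)).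
Let a := - (t ^+ 2 + 1) ^+ 2.
Let b := (2%:R * t) ^+ 2.

Lemma reduces_family_a (F : fieldType) (t' : F) :
  reduces t t' -> reduces a (- (t' ^+ 2 + 1) ^+ 2).
Proof.
move=> rt; apply/reducesN/reducesX/reducesD/(reduces_nat _ 1).
exact: reducesX.
Qed.

Lemma reduces_family_b (F : fieldType) (t' : F) :
  reduces t t' -> reduces b ((2%:R * t') ^+ 2).
Proof. by move=> rt; apply/reducesX/reducesM/rt/reduces_nat. Qed.

Lemma family_cubic_rootless u : u ^+ 3 + a * u + b != 0.
Proof.
apply: (cubic_rootless (reduces_family_a t3) (reduces_family_b t3)).
by apply: forall_Fp; vm_compute.
Qed.

Lemma family_disc_neq0 : disc a b != 0.
Proof. exact/disc_neq0_of_no_root/family_cubic_rootless. Qed.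

Let E := EllCurve family_disc_neq0.

Lemma on_curve_P1 : on_curve E (Some (0, 2%:R * t)).
Proof. by apply/eqP; rewrite /= /a /b; ring. Qed.

Lemma on_curve_P2 : on_curve E (Some (t ^+ 2 + 1, 2%:R * t)).
Proof. by apply/eqP; rewrite /= /a /b; ring. Qed.

Lemma on_curve_P3 : on_curve E (Some (- 1, t * w)).
Proof. by apply/eqP; rewrite /= /a /b exprMn -tw; ring. Qed.

Let P1 : ellPoint E := EllPoint on_curve_P1.
Let P2 : ellPoint E := EllPoint on_curve_P2.
Let P3 : ellPoint E := EllPoint on_curve_P3.

Lemma reduces_P1 (F : fieldType) (t' : F) :
  reduces t t' -> reduces_to P1 0 (2%:R * t').
Proof.
move=> rt; exists 0, (2%:R * t); split=> //; first exact: (reduces_nat _ 0).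
by apply/reducesM/rt/reduces_nat.
Qed.

Lemma reduces_P2 (F : fieldType) (t' : F) :
  reduces t t' -> reduces_to P2 (t' ^+ 2 + 1) (2%:R * t').
Proof.
move=> rt; exists (t ^+ 2 + 1), (2%:R * t); split=> //.
  by apply/reducesD/(reduces_nat _ 1)/reducesX.
by apply/reducesM/rt/reduces_nat.
Qed.

Lemma reduces_P3 (F : fieldType) (t' w' : F) :
  reduces t t' -> reduces w w' -> reduces_to P3 (- 1) (t' * w').
Proof.
move=> rt rw; exists (- 1), (t * w); split=> //; last exact: reducesM.
by apply/reducesN/(reduces_nat _ 1).
Qed.

Lemma rank_ge_family : rank_ge (ellPoint E) 3.
Proof.
apply: (@rank_ge_of_mod2 _ _ (fun i : 'I_3 => nth 0 [:: P1; P2; P3] i))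
  => [|e [j ej] Q].
  exact/no_2torsion/family_cubic_rootless.
(* Coordinates modulo 19; each l is the slope of the chord. *)
have r1 := reduces_P1 t19; have r2 := reduces_P2 t19.
have r3 := reduces_P3 t19 w19.
have r12 : @reduces_to E 'F_19 (P1 + P2) 7%:R 5%:R.
  by apply: (reduces_to_add (l := 0) r1 r2); vm_compute.
have r13 : @reduces_to E 'F_19 (P1 + P3) 2%:R 7%:R.
  by apply: (reduces_to_add (l := - 1) r1 r3); vm_compute.
have r23 : @reduces_to E 'F_19 (P2 + P3) 17%:R 1.
  by apply: (reduces_to_add (l := 16%:R) r2 r3); vm_compute.
have r123 : @reduces_to E 'F_19 (P1 + (P2 + P3)) 11%:R 0.
  by apply: (reduces_to_add (l := 16%:R) r1 r23); vm_compute.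
have nd19 := @not_double E _ _ _ (reduces_family_a t19) (reduces_family_b t19).
have nd5 := @not_double E _ _ _ (reduces_family_a t5) (reduces_family_b t5).
rewrite !big_ord_recl big_ord0 addr0 /=.
case e1: (e ord0); case e2: (e (lift ord0 ord0));
  case e3: (e (lift ord0 (lift ord0 ord0)));
  rewrite ?mulr1n ?mulr0n ?add0r ?addr0.
- by apply: nd19 r123 _ _; apply: forall_Fp; vm_compute.
- by apply: nd19 r12 _ _; apply: forall_Fp; vm_compute.
- by apply: nd19 r13 _ _; apply: forall_Fp; vm_compute.
- by apply: nd19 r1 _ _; apply: forall_Fp; vm_compute.
- by apply: nd19 r23 _ _; apply: forall_Fp; vm_compute.
(* The quartic of P2 has a root modulo 19, but none modulo 5. *)
- by apply: nd5 (reduces_P2 t5) _ _; apply: forall_Fp; vm_compute.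
- by apply: nd19 r3 _ _; apply: forall_Fp; vm_compute.
(* The empty partial sum is excluded by e j. *)
suff : e j = false by rewrite ej.
have [->|[->|->]] //: j = ord0 \/ j = lift ord0 ord0 \/
  j = lift ord0 (lift ord0 ord0).
by case: (j) => -[|[|[|//]]] ?; [left|right; left|right; right]; apply/val_inj.
Qed.

End Family.

(** * Rational points on the conic t ^+ 2 + 6 = w ^+ 2 *)

Definition conic_t (F : fieldType) (m : F) : F := (m ^+ 2 - 6%:R) / (2%:R * m).

Definition conic_w (F : fieldType) (m : F) : F := (m ^+ 2 + 6%:R) / (2%:R * m).

Lemma conicP (m : rat) : m != 0 -> conic_t m ^+ 2 + 6%:R = conic_w m ^+ 2.
Proof. by move=> m0; rewrite /conic_t /conic_w; field. Qed.

(** The parameters m and - 6 / m give the same t, so positivity singles out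
    one of the two. *)
Lemma conic_t_inj (m n : rat) :
  0 < m -> 0 < n -> conic_t m = conic_t n -> m = n.
Proof.
move=> m0 n0 e; apply/eqP; rewrite -subr_eq0.
have : (m - n) * (m * n + 6%:R) = 0.
  have -> : (m - n) * (m * n + 6%:R) = 2%:R * m * n * (conic_t m - conic_t n).
    by rewrite /conic_t; field; rewrite !gt_eqF.
  by rewrite e subrr mulr0.
have pos : 0 < m * n + 6%:R by rewrite addr_gt0 ?mulr_gt0.
by move/eqP; rewrite mulf_eq0 (gt_eqF pos) orbF.
Qed.

Lemma reduces_conic (F : fieldType) (m : rat) (m' : F) :
  reduces m m' -> 2%:R * m' != 0 ->
  reduces (conic_t m) (conic_t m') /\ reduces (conic_w m) (conic_w m').
Proof.
move=> rm m0; have r6 := reduces_nat F 6; have r2 := reduces_nat F 2.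
have rm2 := reducesX 2 rm; have r2m := reducesM r2 rm.
by split; apply: reduces_div => //; [apply: reducesB|apply: reducesD].
Qed.

(** The parameters 285 k + 1 all reduce to 1 in a field where 285 vanishes, so
    their points on the conic all reduce to the same one. *)
Lemma reduces_conic_progression (F : fieldType) (k : nat) (t' w' : F) :
  [&& 285%:R == 0 :> F, 2%:R != 0 :> F, conic_t 1 == t' & conic_w 1 == w'] ->
  reduces (conic_t (285 * k).+1%:R) t' /\ reduces (conic_w (285 * k).+1%:R) w'.
Proof.
case/and4P=> /eqP F285 F2 /eqP <- /eqP <-.
apply: reduces_conic; last by rewrite mulr1.
have -> : 1 = (285 * k).+1%:R :> F.
  by rewrite -natr1 natrM F285 mul0r add0r.
exact: reduces_nat.
Qed.

(** * Infinitely many curves of rank at least 3 *)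

Local Open Scope classical_set_scope.

Theorem theorem6p1 :
  infinite_set [set t : rat |
    exists h : disc (- (t ^+ 2 + 1) ^+ 2) ((2%:R * t) ^+ 2) != 0,
      rank_ge (ellPoint (EllCurve h)) 3].
Proof.
apply/infiniteP/pcard_leP/injfunPex.
exists (fun k : nat => conic_t (285 * k).+1%:R) => [k _|k l _ _ /conic_t_inj].
  have m0 : (285 * k).+1%:R != 0 :> rat by rewrite pnatr_eq0.
  have [t3 _] := @reduces_conic_progression 'F_3 k 2%:R 2%:R isT.
  have [t5 _] := @reduces_conic_progression 'F_5 k 0 1 isT.
  have [t19 w19] := @reduces_conic_progression 'F_19 k 7%:R 13%:R isT.
  exists (family_disc_neq0 t3).
  exact: (@rank_ge_family _ _ (conicP m0) t3 t5 t19 w19).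
rewrite !ltr0n => /(_ isT isT) /(mulrIn (oner_neq0 _)).
by lia.
Qed.
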